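(* Set $\sigma_B:=\frac34$. For $\sigma\in[\frac12,1]$, $$0\text{-}\mathrm{OneMinM}_\sigma>0\quad\text{if and only if}\quad\sigma>\sigma_B.$$ Therefore $\bar\sigma\le\sigma_B$.
   Context: $O=(0,0)$, $|\cdot|$ is the Euclidean norm, $B_\tau(q)\subseteq\mathbb R^2$ is the open disk of radius $\tau$ centered at $q$, and $B_0(q):=\emptyset$. For a finite $P\subseteq\mathbb R^2$ let $\mathcal R(P)$ be the set of functions $r:P\to[0,1]$ such that $B_{r(p)}(p)\cap B_{r(p')}(p')=\emptyset$ for all distinct $p,p'\in P$. For $r\in\mathcal R(P)$ set $U(P,r):=\bigcup_{p\in P}B_{r(p)}(p)$ and $R(P,r):=\inf\{R>0: B_R(O)\supset U(P,r)\}$, with the convention $\mathrm{diam}(U(P,r))=R(P,r)=0$ if $r\equiv0$. Define $$F_\sigma(P,r):=\sum_{p\in P}r(p)-\tfrac1{2\sigma}\min\{\mathrm{diam}(U(P,r)),\tfrac12+R(P,r)\},\qquad M_\sigma(P):=\max\{F_\sigma(P,r): r\in\mathcal R(P)\}.$$ For $p\in\mathbb R^2$, $0<r\le1$, $\Delta_\sigma(p,r)$ is the set of pairs $(q_1,q_2)\in\overline{B_r(p)}\times\overline{B_r(p)}$ with $|q_1-q_2|\ge2\sigma r$. Define $\mathcal F_\sigma(0):=\{\{O\}\}$ and $$\mathcal F_\sigma(k+1):=\Big\{P\cup\bigcup_{p\in P}\{q_{p,1},q_{p,2}\}: P\in\mathcal F_\sigma(k),\ (q_{p,1},q_{p,2})\in\Delta_\sigma(p,1)\text{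 for all }p\in P\Big\},$$ and $k\text{-}\mathrm{OneMinM}_\sigma:=\inf_{P\in\mathcal F_\sigma(k)}M_\sigma(P)$ for integers $k\ge0$. In particular $0\text{-}\mathrm{OneMinM}_\sigma=M_\sigma(\{O\})$. $\bar\sigma$ is the infimum of all numbers $s$ for which the following holds for every Borel set $E\subset\mathbb R^2$ with $\mathcal H^1(E)<\infty$: if $\liminf_{r\downarrow0}\frac{\mathcal H^1(B_r(x)\cap E)}{2r}\ge s$ for $\mathcal H^1$-a.e. $x\in E$, then $E$ is countably $1$-rectifiable (covered, up to an $\mathcal H^1$-null set, by countably many Lipschitz images of $\mathbb R$). *)

(* Defs.v *)
From mathcomp Require Import all_boot all_order all_algebra finmap.
From mathcomp Require Import all_classical all_reals all_analysis.
Import Order.TTheory GRing.Theory Num.Theory.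
Import numFieldNormedType.Exports.

Set Implicit Arguments.
Unset Strict Implicit.
Unset Printing Implicit Defensive.

Local Open Scope classical_set_scope.
Local Open Scope ring_scope.

(* The plane is the type [R * R].  The norm that the library puts on this type
   is the sup norm, so the Euclidean distance is defined explicitly.  The
   library topology on [R * R] is the Euclidean one. *)
Definition eucl_dist (R : realType) (x y : R * R) : R :=
  Num.sqrt ((x.1 - y.1) ^+ 2 + (x.2 - y.2) ^+ 2).

Definition origin (R : realType) : R * R := (0, 0).

(* Empty when [t = 0]. *)
Definition disk (R : realType) (t : R) (q : R * R) : set (R * R) :=
  [set y | eucl_dist q y < t].

(* The added [0] only matters for [A = set0], whose diameter is thus [0]. *)
Definition diam (R : realType) (A : set (R * R)) : \bar R :=
  ereal_sup (0%E |` [set (eucl_dist x.1 x.2)%:E | x in A `*` A]).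

(* A radius function on [P] is represented by a total function on the plane;
   its values outside [P] play no role. *)
Definition radii (R : realType) (P : {fset (R * R)}) : set (R * R -> R) :=
  [set r | (forall p, p \in P -> 0 <= r p <= 1) /\
           (forall p p', p \in P -> p' \in P -> p <> p' ->
              disk (r p) p `&` disk (r p') p' = set0)].

Definition disk_union (R : realType) (P : {fset (R * R)}) (r : R * R -> R) :
    set (R * R) :=
  \bigcup_(p in [set` P]) disk (r p) p.

(* If [r] vanishes on [P], this is the infimum of all positive reals, i.e. 0. *)
Definition outer_radius (R : realType) (P : {fset (R * R)}) (r : R * R -> R) :
    R :=
  inf [set t : R | 0 < t /\ disk_union P r `<=` disk t (origin R)].

(* [fine] is harmless: [disk_union P r] is bounded. *)
Definition Fval (R : realType) (sigma : R) (P : {fset (R * R)})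
    (r : R * R -> R) : R :=
  \sum_(p <- P) r p
  - (2 * sigma)^-1
    * Num.min (fine (diam (disk_union P r))) (2^-1 + outer_radius P r).

(* The supremum is a maximum for [0 < sigma]: [Fval sigma P] depends only on
   the finitely many values of [r] on [P], it is upper semicontinuous in them
   (when a radius tends to 0 the diameter and the outer radius can only jump
   down), and the set of admissible values is compact. *)
Definition Mval (R : realType) (sigma : R) (P : {fset (R * R)}) : R :=
  sup [set Fval sigma P r | r in radii P].

Definition Delta (R : realType) (sigma : R) (p : R * R) (r : R) :
    set ((R * R) * (R * R)) :=
  [set q | [/\ eucl_dist p q.1 <= r, eucl_dist p q.2 <= r
             & 2 * sigma * r <= eucl_dist q.1 q.2]].

Fixpoint config (R : realType) (sigma : R) (k : nat) : set {fset (R * R)} :=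
  match k with
  | 0%N => [set [fset origin R]%fset]
  | k'.+1 =>
      [set Q | exists P : {fset (R * R)}, exists q1 q2 : R * R -> R * R,
         [/\ config sigma k' P,
             (forall p, p \in P -> Delta sigma p 1 (q1 p, q2 p))
           & Q = (P `|` ([fset q1 p | p in P] `|` [fset q2 p | p in P]))%fset]]
  end.

Definition OneMinM (R : realType) (k : nat) (sigma : R) : \bar R :=
  ereal_inf [set (Mval sigma P)%:E | P in config sigma k].

Definition hausdorff1_pre (R : realType) (delta : R) (A : set (R * R)) :
    \bar R :=
  ereal_inf [set s | exists C : nat -> set (R * R),
    [/\ (forall i, (diam (C i) <= delta%:E)%E),
        A `<=` \bigcup_i C i
      & s = (\sum_(0 <= i <oo) diam (C i))%E]].

(* In dimension one, the usual normalizing constant of the Hausdorff measure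
   (for which a segment has its length as measure) is 1. *)
Definition hausdorff1 (R : realType) (A : set (R * R)) : \bar R :=
  ereal_sup [set hausdorff1_pre delta A | delta in [set d : R | 0 < d]].

Definition lower_density (R : realType) (E : set (R * R)) (x : R * R) : \bar R :=
  limf_einf (fun r : R => (hausdorff1 (disk r x `&` E) * ((2 * r)^-1)%:E)%E)
            0^'+.

Definition eucl_lipschitz (R : realType) (f : R -> R * R) : Prop :=
  exists L : R, forall s t : R, eucl_dist (f s) (f t) <= L * `|s - t|.

Definition rectifiable1 (R : realType) (E : set (R * R)) : Prop :=
  exists f : nat -> R -> R * R,
    (forall n, eucl_lipschitz (f n)) /\
    hausdorff1 (E `\` \bigcup_n range (f n)) = 0%E.

Definition borel (R : realType) (E : set (R * R)) : Prop :=
  <<s [set U : set (R * R) | open U] >> E.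

Definition rectifiability_threshold (R : realType) (s : R) : Prop :=
  forall E : set (R * R), borel E -> (hausdorff1 E < +oo)%E ->
    hausdorff1 (E `&` [set x | ~ (s%:E <= lower_density E x)%E]) = 0%E ->
    rectifiable1 E.

Definition sigma_bar (R : realType) : \bar R :=
  ereal_inf [set s%:E | s in [set s : R | rectifiability_threshold s]].

Definition sigmaB (R : realType) : R := 3 / 4.

(* Main.v *)
(* Let s > 3/4 and let E have lower density at least s almost everywhere.  For
   nearby points x, y of a large part of E, at distance r, the disks of radius
   almost r around x and y both carry measure at least 2 alpha r with
   alpha > 3/4, while their union, of diameter at most 3r, carries at most about
   3r (the upper convex density is at most 1 almost everywhere); hence the lens
   in which they meet carries measure at least c r.  In a minimal spanning tree of
   a finite set of such points, the slightly shrunk lenses of the edges overlap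
   boundedly, because no vertex lies in the open lens of an edge.  Therefore the length of
   the tree is bounded by a multiple of H^1(E), independently of the finite set,
   and going around the tree parametrizes the finite set by arc length.  A
   compactness argument yields the inverse of a Lipschitz parametrization of the
   whole part. *)

From HB Require Import structures.
Require Import Defs.
From mathcomp Require Import all_boot all_order all_algebra finmap.
From mathcomp Require Import all_classical all_reals all_analysis.
From mathcomp Require Import ring lra.
Import Order.TTheory GRing.Theory Num.Theory.
Import numFieldNormedType.Exports.

Set Implicit Arguments.
Unset Strict Implicit.
Unset Printing Implicit Defensive.

Local Open Scope classical_set_scope.
Local Open Scope ring_scope.

(** * Euclidean distance, diameters and disks *)

Section plane.
Context {R : realType}.
Implicit Types (x y z : R * R) (A B : set (R * R)).

Lemma eucl_dist_ge0 x y : 0 <= eucl_dist x y.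
Proof. exact: sqrtr_ge0. Qed.

Lemma eucl_distC x y : eucl_dist x y = eucl_dist y x.
Proof. by rewrite /eucl_dist; congr Num.sqrt; ring. Qed.

Lemma eucl_distxx x : eucl_dist x x = 0.
Proof. by rewrite /eucl_dist !subrr expr0n addr0 sqrtr0. Qed.

Lemma eucl_dist_sqr x y :
  eucl_dist x y ^+ 2 = (x.1 - y.1) ^+ 2 + (x.2 - y.2) ^+ 2.
Proof. by rewrite sqr_sqrtr// addr_ge0// sqr_ge0. Qed.

Lemma eucl_dist_leP x y (d : R) : 0 <= d ->
  (eucl_dist x y <= d) = ((x.1 - y.1) ^+ 2 + (x.2 - y.2) ^+ 2 <= d ^+ 2).
Proof.
by move=> d0; rewrite -eucl_dist_sqr ler_pXn2r// nnegrE ?eucl_dist_ge0.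
Qed.

Lemma eucl_dist_triangle y x z :
  eucl_dist x z <= eucl_dist x y + eucl_dist y z.
Proof.
rewrite eucl_dist_leP ?addr_ge0 ?eucl_dist_ge0//.
have := eucl_dist_sqr x y; have := eucl_dist_sqr y z.
have := eucl_dist_ge0 x y; have := eucl_dist_ge0 y z.
set p := eucl_dist x y; set q := eucl_dist y z.
set a := x.1 - y.1; set b := x.2 - y.2; set c := y.1 - z.1; set d := y.2 - z.2.
move=> q0 p0 qE pE.
have -> : x.1 - z.1 = a + c by rewrite /a /c; ring.
have -> : x.2 - z.2 = b + d by rewrite /b /d; ring.
have : a * c + b * d <= p * q.
  apply: le_trans (ler_norm _) _.
  rewrite -(@ler_pXn2r _ 2)// ?nnegrE ?mulr_ge0// real_normK ?num_real//.
  rewrite exprMn pE qE; have := sqr_ge0 (a * d - b * c); nra.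
by nra.
Qed.

Lemma le_eucl_dist1 x y : `|x.1 - y.1| <= eucl_dist x y.
Proof.
rewrite -(@ler_pXn2r _ 2)// ?nnegrE ?eucl_dist_ge0//.
by rewrite real_normK ?num_real// eucl_dist_sqr lerDl sqr_ge0.
Qed.

Lemma le_eucl_dist2 x y : `|x.2 - y.2| <= eucl_dist x y.
Proof.
rewrite -(@ler_pXn2r _ 2)// ?nnegrE ?eucl_dist_ge0//.
by rewrite real_normK ?num_real// eucl_dist_sqr lerDr sqr_ge0.
Qed.

Lemma eucl_dist_le_sum x y : eucl_dist x y <= `|x.1 - y.1| + `|x.2 - y.2|.
Proof.
rewrite eucl_dist_leP ?addr_ge0// -(real_normK (num_real (x.1 - y.1))).
rewrite -(real_normK (num_real (x.2 - y.2))).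
have := normr_ge0 (x.1 - y.1); have := normr_ge0 (x.2 - y.2); nra.
Qed.

Lemma diam_ge0 A : (0 <= diam A)%E.
Proof. by apply: ereal_sup_ubound; left. Qed.

Lemma diam_ge A x y : A x -> A y -> ((eucl_dist x y)%:E <= diam A)%E.
Proof. by move=> Ax Ay; apply: ereal_sup_ubound; right; exists (x, y). Qed.

Lemma diam_le A (d : R) : 0 <= d ->
  (forall x y, A x -> A y -> eucl_dist x y <= d) -> (diam A <= d%:E)%E.
Proof.
move=> d0 Ad; apply: ge_ereal_sup => _ [->|[[x y] [/= Ax Ay] <-]].
  by rewrite lee_fin.
by rewrite lee_fin Ad.
Qed.

Lemma diam0 : diam (@set0 (R * R)) = 0%E.
Proof.
by apply/eqP; rewrite eq_le diam_ge0 andbT; exact: diam_le.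
Qed.

Lemma diam_subset A B : A `<=` B -> (diam A <= diam B)%E.
Proof.
move=> AB; apply: ge_ereal_sup => _ [->|[[x y] [/= Ax Ay] <-]].
  exact: diam_ge0.
by apply: diam_ge; exact: AB.
Qed.

Lemma disk_sub x y (s t : R) : eucl_dist x y + s <= t -> disk s y `<=` disk t x.
Proof.
move=> st z; rewrite /disk /= => zs.
have := eucl_dist_triangle y x z; lra.
Qed.

End plane.

(** * The one-dimensional Hausdorff measure as an outer measure *)

Section hausdorff_outer_measure.
Context {R : realType}.
Implicit Types (A B X : set (R * R)) (d : R).

Local Notation plane := (g_sigma_algebraType [set: set (R * R)]).

(* The premeasure at scale [d] is Caratheodory's outer extension, with respect
   to the discrete sigma-algebra, of the diameter truncated to [+oo] above [d];
   countable subadditivity then comes from the library. *)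
Let gauge d (A : set plane) : \bar R :=
  if (diam (A : set (R * R)) <= d%:E)%E then diam (A : set (R * R)) else +oo%E.

Let gauge_ge0 d A : (0 <= gauge d A)%E.
Proof. by rewrite /gauge; case: ifP => // _; exact: diam_ge0. Qed.

(** A cover with a piece of diameter above [d] has an infinite series of gauges, so it cannot lower
    the infimum. *)
Lemma hausdorff1_pre_mu_ext d A : 0 < d ->
  hausdorff1_pre d A = mu_ext (gauge d) (A : set plane).
Proof.
move=> d0; apply/eqP; rewrite eq_le; apply/andP; split; last first.
  apply: le_ereal_inf_tmp => _ [C [Cd AC ->]]; apply: ereal_inf_lbound.
  exists C; first by split => // i; exact: sub_gen_smallest.
  by apply: eq_eseriesr => i _; rewrite /gauge Cd.
apply: le_ereal_inf_tmp => _ [C [_ AC] <-].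
have [Cd|] := pselect (forall i, (diam (C i : set (R * R)) <= d%:E)%E).
  apply: ereal_inf_lbound; exists C; split => //.
  by apply: eq_eseriesr => i _; rewrite /gauge Cd.
move=> /existsNP[i /negP Cid].
rewrite (@eseries_pinfty _ _ _ i) ?leey//; last by rewrite /gauge (negbTE Cid).
by move=> n _; rewrite gt_eqF// (lt_le_trans _ (gauge_ge0 _ _)).
Qed.

Let gauge0 d : 0 < d -> gauge d set0 = 0%E.
Proof. by move=> d0; rewrite /gauge diam0 lee_fin ltW. Qed.

Lemma hausdorff1_pre_ge0 d A : (0 <= hausdorff1_pre d A)%E.
Proof.
apply: le_ereal_inf_tmp => _ [C [_ _ ->]]; apply: nneseries_ge0 => i _ _.
exact: diam_ge0.
Qed.

Lemma hausdorff1_pre0 d : 0 < d -> hausdorff1_pre d (@set0 (R * R)) = 0%E.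
Proof.
by move=> d0; rewrite hausdorff1_pre_mu_ext// mu_ext0//; exact: gauge0.
Qed.

Lemma le_hausdorff1_pre d : {homo @hausdorff1_pre R d : A B / A `<=` B >-> (A <= B)%E}.
Proof.
move=> A B AB; apply: ereal_inf_le_tmp => s [C [Cd BC sE]].
by exists C; split => //; exact: subset_trans BC.
Qed.

Lemma hausdorff1_pre_anti d d' A : d <= d' ->
  (hausdorff1_pre d' A <= hausdorff1_pre d A)%E.
Proof.
move=> dd; apply: ereal_inf_le_tmp => s [C [Cd BC sE]].
by exists C; split => // i; rewrite (le_trans (Cd i))// lee_fin.
Qed.

Lemma hausdorff1_pre_sigma_subadditive d : 0 < d ->
  sigma_subadditive (@hausdorff1_pre R d).
Proof.
move=> d0 A; rewrite hausdorff1_pre_mu_ext//.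
apply: le_trans (@mu_ext_sigma_subadditive _ plane R _ (gauge_ge0 d) A) _.
apply: lee_nneseries => [n _ _|n _]; first exact: mu_ext_ge0.
by rewrite hausdorff1_pre_mu_ext.
Qed.

Lemma hausdorff1_pre_diam d A : 0 < d -> (diam A <= d%:E)%E ->
  (hausdorff1_pre d A <= diam A)%E.
Proof.
move=> d0 Ad; apply: ereal_inf_lbound; exists (fun i => if i is 0%N then A else set0).
split; first by case=> // _; rewrite diam0 lee_fin ltW.
  by move=> x Ax; exists 0%N.
rewrite nneseries_recl//=; last by case=> [|n] _; exact: diam_ge0.
by rewrite eseries0 ?adde0//; case=> // n _ _; exact: diam0.
Qed.

Lemma hausdorff1_pre_le d A : 0 < d -> (hausdorff1_pre d A <= hausdorff1 A)%E.
Proof. by move=> d0; apply: ereal_sup_ubound; exists d. Qed.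

Lemma hausdorff1_le A (a : \bar R) :
  (forall d, 0 < d -> (hausdorff1_pre d A <= a)%E) -> (hausdorff1 A <= a)%E.
Proof. by move=> Aa; apply: ge_ereal_sup => _ [d d0 <-]; exact: Aa. Qed.

Let hausdorff1_0 : hausdorff1 (@set0 (R * R)) = 0%E.
Proof.
apply/eqP; rewrite eq_le; apply/andP; split.
  by apply: hausdorff1_le => d d0; rewrite hausdorff1_pre0.
exact: le_trans (hausdorff1_pre_ge0 _ _) (hausdorff1_pre_le _ ltr01).
Qed.

Let hausdorff1_ge0 A : (0 <= hausdorff1 A)%E.
Proof. exact: le_trans (hausdorff1_pre_ge0 _ _) (hausdorff1_pre_le _ ltr01). Qed.

Let le_hausdorff1 : {homo @hausdorff1 R : A B / A `<=` B >-> (A <= B)%E}.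
Proof.
move=> A B AB; apply: hausdorff1_le => d d0.
by rewrite (le_trans (le_hausdorff1_pre _ AB))// hausdorff1_pre_le.
Qed.

Let hausdorff1_sigma_subadditive : sigma_subadditive (@hausdorff1 R).
Proof.
move=> A; apply: hausdorff1_le => d d0.
apply: le_trans (hausdorff1_pre_sigma_subadditive d0 _) _.
apply: lee_nneseries => [n _ _|n _]; first exact: hausdorff1_pre_ge0.
exact: hausdorff1_pre_le.
Qed.

HB.instance Definition _ := isOuterMeasure.Build R (R * R)%type (@hausdorff1 R)
  hausdorff1_0 hausdorff1_ge0 le_hausdorff1 hausdorff1_sigma_subadditive.

End hausdorff_outer_measure.

(** * Additivity on separated sets and Caratheodory measurability of disks *)

Section hausdorff_metric.
Context {R : realType}.
Implicit Types (A B X : set (R * R)) (d : R).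

(** A piece of diameter at most [d < e] cannot meet both sets, so each cover of the union splits
    into a cover of [A] and a cover of [B]. *)
Lemma hausdorff1_pre_separated A B e d : 0 < d -> d < e ->
  (forall x y, A x -> B y -> e <= eucl_dist x y) ->
  (hausdorff1_pre d A + hausdorff1_pre d B <= hausdorff1_pre d (A `|` B))%E.
Proof.
move=> d0 de sep; apply: le_ereal_inf_tmp => _ [C [Cd ABC ->]].
have CI i : (diam (C i `&` A) + diam (C i `&` B) <= diam (C i))%E.
  have [[x [Cx Ax]]|CA0] := pselect (C i `&` A !=set0); last first.
    have -> : C i `&` A = set0 by apply: contra_notP CA0 => /eqP/set0P.
    by rewrite diam0 add0e; exact: diam_subset.
  have -> : C i `&` B = set0.
    rewrite -subset0 => y [Cy By] /=.
    have := le_trans (diam_ge Cx Cy) (Cd i).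
    by rewrite lee_fin leNgt (lt_le_trans de)// sep.
  by rewrite diam0 adde0; exact: diam_subset.
apply: (@le_trans _ _ (\sum_(0 <= i <oo) (diam (C i `&` A) + diam (C i `&` B)))%E);
  last first.
  by apply: lee_nneseries => [i _ _|i _]; rewrite ?adde_ge0 ?diam_ge0.
rewrite nneseriesD; [|by move=> *; exact: diam_ge0..].
apply: leeD; apply: ereal_inf_lbound.
  exists (fun i => C i `&` A); split => //.
    by move=> i; rewrite (le_trans (diam_subset (@subIsetl _ _ _))).
  by move=> x Ax; have [|i _ Cx] := ABC x; [left|exists i].
exists (fun i => C i `&` B); split => //.
  by move=> i; rewrite (le_trans (diam_subset (@subIsetl _ _ _))).
by move=> x Ax; have [|i _ Cx] := ABC x; [right|exists i].
Qed.

Lemma hausdorff1_separated A B e : 0 < e ->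
  (forall x y, A x -> B y -> e <= eucl_dist x y) ->
  (hausdorff1 A + hausdorff1 B <= hausdorff1 (A `|` B))%E.
Proof.
move=> e0 sep; have [->|ABoo] := eqVneq (hausdorff1 (A `|` B)) +oo%E.
  by rewrite leey.
have fin X : X `<=` A `|` B -> hausdorff1 X \is a fin_num.
  move=> XAB; rewrite ge0_fin_numE ?outer_measure_ge0//.
  by rewrite (le_lt_trans (le_outer_measure (@hausdorff1 R) _ _ XAB))// ltey.
have finp d X : 0 < d -> X `<=` A `|` B -> hausdorff1_pre d X \is a fin_num.
  move=> d0 XAB; rewrite ge0_fin_numE ?hausdorff1_pre_ge0//.
  rewrite (le_lt_trans (hausdorff1_pre_le _ d0))//.
  by rewrite -ge0_fin_numE ?fin ?outer_measure_ge0.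
rewrite -leeBrDl ?fin//; apply: hausdorff1_le => d2 d20.
rewrite leeBrDl ?fin// addeC -leeBrDl ?finp//; apply: hausdorff1_le => d1 d10.
rewrite leeBrDl ?finp//.
(* The scales for the two sets were chosen independently; a common finer one below the separation
   [e] only raises both premeasures. *)
pose d := Num.min (Num.min d1 d2) (e / 2).
have d0 : 0 < d by rewrite !lt_min d10 d20 divr_gt0.
have de : d < e by rewrite gt_min; apply/orP; right; lra.
apply: le_trans (hausdorff1_pre_le _ d0).
apply: le_trans (hausdorff1_pre_separated d0 de sep).
rewrite addeC leeD//; apply: hausdorff1_pre_anti; rewrite !ge_min lexx ?orbT//.
Qed.

(* The disk is exhausted by concentric disks [D k]; the parts of [X] in the
   annuli [D k.+1 \ D k] have summable measure, because nonadjacent annuli are at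
   positive distance. *)
Lemma disk_caratheodory (q : R * R) (t : R) :
  (@hausdorff1 R).-caratheodory (disk t q).
Proof.
have [t0|t0] := leP t 0.
  have -> : disk t q = set0.
    by rewrite -subset0 => x; rewrite /disk /= ltNge (le_trans t0)// eucl_dist_ge0.
  exact: (caratheodory_measurable_set0 (@hausdorff1 R)).
apply: (@le_caratheodory_measurable _ _ (@hausdorff1 R)) => X /=.
have [->|Xoo] := eqVneq (hausdorff1 X) +oo%E; first by rewrite leey.
have finX : (hausdorff1 X < +oo)%E by rewrite ltey.
(* The radii start at [s 0 = 0], so [D 0] is empty and the annuli exhaust the whole disk. *)
pose s (k : nat) := t * (1 - k.+1%:R^-1) : R.
have s_lt k l : (k < l)%N -> s k < s l.
  move=> kl; rewrite /s ltr_pM2l// ltrD2l ltrN2 ltf_pV2 ?posrE// ltr_nat.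
  by rewrite ltnS.
have st k : s k < t by rewrite /s gtr_pMr// gtrBl invr_gt0.
pose D k := disk (s k) q.
pose Rg k := X `&` (D k.+1 `\` D k).
have Dle k l : (k <= l)%N -> D k `<=` D l.
  rewrite leq_eqVlt => /predU1P[->//|/s_lt kl] x.
  by rewrite /D /disk /= => /lt_trans; apply.
have D0 : D 0%N = set0.
  rewrite -subset0 => x; rewrite /D /disk /= /s invr1 subrr mulr0.
  by rewrite ltNge eucl_dist_ge0.
have sepD a b (A B : set (R * R)) : a < b -> A `<=` disk a q -> B `<=` ~` disk b q ->
    (hausdorff1 A + hausdorff1 B <= hausdorff1 (A `|` B))%E.
  move=> ab Aa Bb; apply: (@hausdorff1_separated _ _ (b - a)).
    by rewrite subr_gt0.
  move=> x y /Aa; rewrite /disk /= => qx /Bb; rewrite /disk /= => /negP.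
  by rewrite -leNgt => qy; have := eucl_dist_triangle x q y; lra.
have le_H := le_outer_measure (@hausdorff1 R).
(* Annuli of even and odd index are summed separately: [Rg n.+1] is at positive distance from [D n],
   so both fit additively into [D n.+2], while the term of [D n.+1] is carried over. *)
have sumR n : (\sum_(0 <= k < n.+1) hausdorff1 (Rg k) <=
    hausdorff1 (X `&` D n) + hausdorff1 (X `&` D n.+1))%E.
  elim: n => [|n IH].
    rewrite big_nat1 -[leLHS]add0e leeD ?outer_measure_ge0//.
    by apply: le_H; rewrite /Rg D0 setD0.
  rewrite big_nat_recr//=; apply: le_trans (leeD2r _ IH) _.
  rewrite [X in (X + _ <= _)%E]addeC -addeA leeD2l//.
  apply: le_trans (sepD (s n) (s n.+1) _ _ _ _ _) _.
  - exact: s_lt.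
  - exact: subIsetr.
  - by move=> x [_ [_]].
  - apply: le_H => x [[Xx Dx]|[Xx [Dx _]]]; split => //.
    by apply: Dle Dx; rewrite ltnW.
have sumfin : (\sum_(0 <= k <oo) hausdorff1 (Rg k) < +oo)%E.
  apply: (@le_lt_trans _ _ (hausdorff1 X + hausdorff1 X)%E); last first.
    exact: lte_add_pinfty.
  apply: lime_le; first by apply: is_cvg_nneseries => *; exact: outer_measure_ge0.
  apply: nearW => -[|n].
    by rewrite big_geq// adde_ge0// outer_measure_ge0.
  by apply: le_trans (sumR n) _; apply: leeD; apply: le_H; exact: subIsetl.
have tail := nneseries_tail_cvg sumfin
  (fun k _ => outer_measure_ge0 (@hausdorff1 R) (Rg k)).
have XD n : (hausdorff1 (X `&` disk t q) + hausdorff1 (X `&` ~` disk t q) <=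
    hausdorff1 X + \sum_(n <= k <oo) hausdorff1 (Rg k))%E.
  have XDn : (hausdorff1 (X `&` disk t q) <=
      hausdorff1 (X `&` D n) + \sum_(n <= k <oo) hausdorff1 (Rg k))%E.
    rewrite -nneseries_addn; last by move=> *; exact: outer_measure_ge0.
    apply: le_trans (leeD2l _ (outer_measure_sigma_subadditive (@hausdorff1 R) _)).
    apply: le_trans (outer_measureU2 _ _ _); apply: le_H => x [Xx xt].
    have [xn|xn] := pselect (D n x); [by left|right].
    have ex : exists k, `[< D k x >].
      move: xt; rewrite /disk /= => xt.
      have [k kt] : exists k : nat, t / (t - eucl_dist q x) < k%:R.
        by exists (Num.trunc (t / (t - eucl_dist q x))).+1; exact: truncnS_gt.
      exists k; apply/asboolP; rewrite /D /disk /= /s.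
      have tx : 0 < t - eucl_dist q x by rewrite subr_gt0.
      move: kt; rewrite ltr_pdivrMr// => kt.
      rewrite mulrBr mulr1 ltrBrDr -ltrBrDl.
      rewrite ltr_pdivrMr// mulrC -natr1.
      by move: kt tx; set u := k%:R; set v := eucl_dist q x; nra.
    (* The least [k] with [D k x] places [x] in the annulus of index [k.-1], which is at least
       [n]. *)
    pose k := ex_minn ex.
    have [Dk kmin] : D k x /\ forall j, D j x -> (k <= j)%N.
      rewrite /k; case: ex_minnP => m /asboolP Dm mmin; split => // j Dj.
      by apply: mmin; exact/asboolP.
    have nk : (n < k)%N.
      by rewrite ltnNge; apply/negP => kn; exact/xn/(Dle k).
    exists (k.-1 - n)%N => //; split => //.
    have -> : (k.-1 - n + n)%N = k.-1 by rewrite subnK// -ltnS prednK// (leq_trans _ nk).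
    rewrite prednK ?(leq_trans _ nk)//; split => // /kmin.
    by rewrite leqNgt prednK ?leqnn// (leq_trans _ nk).
  apply: le_trans (leeD2r _ XDn) _; rewrite addeAC leeD2r//.
  apply: le_trans (sepD (s n) t _ _ (st n) (@subIsetr _ _ _) (@subIsetr _ _ _)) _.
  by apply: le_H => x [[]|[]].
have : (hausdorff1 X + \sum_(n <= k <oo) hausdorff1 (Rg k))%E @[n --> \oo]
    --> (hausdorff1 X + 0)%E.
  apply: cvgeD => //; last exact: cvg_cst.
  by rewrite fin_num_adde_defl.
by rewrite adde0 => /cvge_to_ge; apply; apply: nearW.
Qed.

End hausdorff_metric.

(** * Finite disjoint families and Vitali selection *)

Section finite_caratheodory.
Context {R : realType} {T : Type} (mu : {outer_measure set T -> \bar R}).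
Context {I : choiceType} (V : I -> set T).

Lemma caratheodory_bigsetU (s : seq I) :
  {in s, forall i, mu.-caratheodory (V i)} ->
  mu.-caratheodory (\big[setU/set0]_(i <- s) V i).
Proof.
elim: s => [|i s IH] sV; first by rewrite big_nil; exact: caratheodory_measurable_set0.
rewrite big_cons; apply: caratheodory_measurable_setU.
  by apply: sV; rewrite mem_head.
by apply: IH => j js; apply: sV; rewrite inE js orbT.
Qed.

Lemma disj_set_bigsetU (A : set T) (s : seq I) :
  all (fun i => disj_set A (V i)) s -> disj_set A (\big[setU/set0]_(i <- s) V i).
Proof.
rewrite -bigcup_seq => /allP As; apply/disj_set2P; rewrite -subset0.
move=> x [Ax [i /= /As]] /disj_set2P; rewrite -subset0 => + Vx; apply.
by split; [exact: Ax|].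
Qed.

Lemma caratheodory_sum (X : set T) (s : seq I) :
  {in s, forall i, mu.-caratheodory (V i)} ->
  pairwise (fun i j => disj_set (V i) (V j)) s ->
  mu (X `&` \big[setU/set0]_(i <- s) V i) = (\sum_(i <- s) mu (X `&` V i))%E.
Proof.
elim: s => [|i s IH] sV; first by rewrite !big_nil setI0 outer_measure0.
rewrite pairwise_cons => /andP[/disj_set_bigsetU iVs sdisj].
rewrite !big_cons disjoint_caratheodoryIU//.
- by rewrite IH// => j js; apply: sV; rewrite inE js orbT.
- by apply: sV; rewrite mem_head.
- by apply: caratheodory_bigsetU => j js; apply: sV; rewrite inE js orbT.
Qed.

End finite_caratheodory.

(* Greedy selection: at each stage take a set disjoint from the previous ones
   whose weight is at least half the supremum of the available weights. *)
Lemma vitali_sequence {R : realType} {T : Type} {I : choiceType} (V : set I)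
    (S : I -> set T) (w : I -> R) (K : R) :
  (forall i, V i -> 0 < w i) ->
  (forall s : seq I, {in s, forall i, V i} ->
     pairwise (fun i j => disj_set (S i) (S j)) s -> \sum_(i <- s) w i <= K) ->
  exists o : nat -> option I,
    [/\ forall n i, o n = Some i -> V i,
        forall i, V i -> exists n j,
          [/\ o n = Some j, ~ disj_set (S i) (S j) & w i <= 2 * w j]
      & forall n, \sum_(k < n) oapp w 0 (o k) <= K].
Proof.
move=> w0 wK.
pose elig (D : seq I) i := V i /\ {in D, forall j, disj_set (S i) (S j)}.
have /choice[step stepP] (D : seq I) : exists o, if o is Some i
    then elig D i /\ forall j, elig D j -> w j <= 2 * w i
    else forall i, ~ elig D i.
  have [[i0 ei0]|/forallNP no] := pselect (exists i, elig D i); last by exists None.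
  have supD : has_sup [set w i | i in elig D].
    split; first by exists (w i0), i0.
    exists K => _ [i [Vi _] <-].
    have -> : w i = \sum_(j <- [:: i]) w j by rewrite big_seq1.
    apply: wK => //.
    by move=> j; rewrite inE => /eqP ->.
  have sup0 : 0 < sup [set w i | i in elig D].
    by apply: lt_le_trans (ub_le_sup supD.2 _); [exact: (w0 i0 ei0.1)|exists i0].
  have [_ [i ei <-] wi] := sup_adherent (divr_gt0 sup0 (ltr0n _ 2)) supD.
  exists (Some i); split => // j ej.
  have := ub_le_sup supD.2 (ex_intro2 _ _ j ej erefl); lra.
pose D := fix D n := if n is n'.+1 then oapp (cons^~ (D n')) (D n') (step (D n'))
                     else [::].
have DV n : {in D n, forall i, V i}.
  elim: n => // n IH /=; have := stepP (D n); case: (step (D n)) => //= i [[Vi _] _] j.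
  by rewrite inE => /predU1P[->//|/IH].
have Ddisj n : pairwise (fun i j => disj_set (S i) (S j)) (D n).
  elim: n => // n IH /=; have := stepP (D n); case: (step (D n)) => //= i [[_ ei] _].
  by rewrite IH andbT; exact/allP.
have Dsum n : \sum_(k < n) oapp w 0 (step (D k)) = \sum_(i <- D n) w i.
  elim: n => [|n IH]; first by rewrite big_ord0 big_nil.
  rewrite big_ord_recr/= IH; case: (step (D n)) => [i|] /=; last by rewrite addr0.
  by rewrite big_cons addrC.
exists (step \o D); split => [n i /= sD|i Vi|n] /=.
- by have := stepP (D n); rewrite sD => -[[]].
- have [n en] : exists n, ~ elig (D n) i.
    apply/not_existsP => ei.
    (* If [i] stayed eligible forever, each stage would add at least [w i / 2] and the total would
       exceed [K]. *)
    have Dn n : n%:R * (w i / 2) <= \sum_(i <- D n) w i.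
      elim: n => [|n IH]; first by rewrite mul0r big_nil.
      rewrite -natr1 mulrDl mul1r -Dsum big_ord_recr/= Dsum lerD//.
      have := stepP (D n); case: (step (D n)) => /= [j [_]|].
        by move=> /(_ i (contrapT (ei n))); lra.
      by move=> /(_ i)/(ei n).
    have wi2 : 0 < w i / 2 by rewrite divr_gt0// w0.
    have := truncnS_gt (K / (w i / 2)); rewrite ltr_pdivrMr//.
    by rewrite ltNge (le_trans (Dn _))// wK.
  (* Go back to the stage at which [i] loses its eligibility: the set selected there meets that of
     [i] and has at least half its weight. *)
  elim: n en => [|n IH] en; first by case: en.
  have [ein|/IH//] := pselect (elig (D n) i).
  have := stepP (D n); case sn : (step (D n)) => [j|]; last by move/(_ i).
  move=> [_ /(_ i ein) wij]; exists n, j; split => // Sij; apply: en.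
  split=> // k; rewrite /= sn/= inE => /predU1P[->//|]; exact: ein.2.
- by rewrite Dsum wK.
Qed.

(** * Upper density of a set in the union of two disks *)

Section convex_density.
Context {R : realType}.
Implicit Types (x y : R * R) (E A B : set (R * R)).

(** Covering [E] by the [V i] together with fine covers of the rest costs at most the sum of the
    [w i] plus the measure of the rest. As the union splits the measure of [E], the finite measure
    of the rest cancels. *)
Lemma hausdorff1_bigsetU_le E (rho eps : R) (I : choiceType) (s : seq I)
    (V : I -> set (R * R)) (w : I -> R) :
  0 < rho -> (hausdorff1 E < +oo)%E ->
  (hausdorff1 E <= hausdorff1_pre rho E + eps%:E)%E ->
  {in s, forall i, (@hausdorff1 R).-caratheodory (V i)} ->
  {in s, forall i, (diam (V i) <= (w i)%:E)%E /\ w i <= rho} ->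
  (hausdorff1 (E `&` \big[setU/set0]_(i <- s) V i) <=
   (\sum_(i <- s) w i)%:E + eps%:E)%E.
Proof.
move=> rho0 Efin Erho sV sw; set U := \big[setU/set0]_(i <- s) V i.
have preU A B : (hausdorff1_pre rho (A `|` B) <=
    hausdorff1_pre rho A + hausdorff1_pre rho B)%E.
  rewrite -bigcup2E; apply: le_trans (hausdorff1_pre_sigma_subadditive rho0 _) _.
  rewrite (nneseries_split _ 2); last by move=> *; exact: hausdorff1_pre_ge0.
  rewrite eseries0 ?adde0; last by case=> [|[|n]]//= _ _; rewrite hausdorff1_pre0//.
  by rewrite !big_nat_recl//= big_geq// adde0.
have preV : (hausdorff1_pre rho U <= (\sum_(i <- s) w i)%:E)%E.
  rewrite /U; elim: s sV sw {U} => [|i s IH] sV sw.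
    by rewrite !big_nil hausdorff1_pre0.
  rewrite !big_cons EFinD; apply: le_trans (preU _ _) _; apply: leeD.
    have [wi wrho] := sw i (mem_head _ _).
    apply: le_trans wi; apply: hausdorff1_pre_diam => //.
    by rewrite (le_trans (sw i (mem_head _ _)).1)// lee_fin.
  by apply: IH => j js; [apply: sV|apply: sw]; rewrite inE js orbT.
have mU := caratheodory_bigsetU sV.
have finU : hausdorff1 (E `&` ~` U) \is a fin_num.
  rewrite ge0_fin_numE ?outer_measure_ge0//; apply: le_lt_trans Efin.
  by apply: (le_outer_measure (@hausdorff1 R)); exact: subIsetl.
move: Erho; rewrite (mU E) -/U => Erho.
rewrite -(leeD2rE _ _ finU).
apply: le_trans Erho _; rewrite [leRHS]addeAC leeD2r//.
apply: le_trans (leeD preV (hausdorff1_pre_le _ rho0)).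
apply: le_trans (preU _ _); apply: le_hausdorff1_pre => x Ex.
by have [Ux|Ux] := pselect (U x); [left|right].
Qed.

Definition two_disks (kap : R) x y : set (R * R) :=
  disk (kap * eucl_dist x y) x `|` disk (kap * eucl_dist x y) y.

Lemma two_disks_caratheodory kap x y :
  (@hausdorff1 R).-caratheodory (two_disks kap x y).
Proof.
by apply: (@caratheodory_measurable_setU _ _ (@hausdorff1 R)); exact: disk_caratheodory.
Qed.

Lemma diam_two_disks kap x y : 0 <= kap ->
  (diam (two_disks kap x y) <= ((1 + 2 * kap) * eucl_dist x y)%:E)%E.
Proof.
move=> kap0; have xy0 := eucl_dist_ge0 x y.
have kxy : 0 <= kap * eucl_dist x y by exact: mulr_ge0.
apply: diam_le => [|u v]; first by rewrite mulr_ge0//; lra.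
rewrite /two_disks /disk /= => -[xu|yu] [xv|yv].
- have := eucl_dist_triangle x u v; rewrite (eucl_distC u x); lra.
- have := eucl_dist_triangle x u v; have := eucl_dist_triangle y x v.
  rewrite (eucl_distC u x); lra.
- have := eucl_dist_triangle y u v; have := eucl_dist_triangle x y v.
  rewrite (eucl_distC u y) (eucl_distC y x); lra.
- have := eucl_dist_triangle y u v; rewrite (eucl_distC u y); lra.
Qed.

(* If [hausdorff1_pre rho E] is within [eps] of the measure of [E], disjoint sets
   of diameter at most [rho] in which [E] has density larger than [1 + e0] have
   a total diameter of order [eps / e0]. *)
Lemma two_disks_density E (kap e0 : R) : 0 < kap -> kap < 1 -> 0 < e0 ->
  (hausdorff1 E < +oo)%E ->
  hausdorff1 [set x | E x /\ forall d, 0 < d -> exists y,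
    [/\ 0 < eucl_dist x y, eucl_dist x y < d &
    (((1 + e0) * ((1 + 2 * kap) * eucl_dist x y))%:E <
       hausdorff1 (E `&` two_disks kap x y))%E]] = 0%E.
Proof.
move=> kap0 kap1 e00 Efin; set Bad := [set x | _].
apply/eqP; rewrite eq_le outer_measure_ge0 andbT; apply: hausdorff1_le => d d0.
apply/lee_addgt0Pr => e e_gt0; rewrite add0e.
(* For a disjoint family of pairs of total length [S], the excess density gives
   [e0 * (1 + 2 * kap) * S <= eps], that is [S <= K]. The enlarged disks below then have total
   diameter at most [14 * K = e]. *)
pose K := e / 14; pose eps := K * (e0 * (1 + 2 * kap)).
have K0 : 0 < K by rewrite divr_gt0.
have c0 : 0 < 1 + 2 * kap by lra.
have eps0 : 0 < eps by rewrite !mulr_gt0.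
have [rho [rho0 Erho]] : exists rho, 0 < rho /\
    (hausdorff1 E <= hausdorff1_pre rho E + eps%:E)%E.
  have fE : hausdorff1 E \is a fin_num by rewrite ge0_fin_numE// outer_measure_ge0.
  have [_ [rho rho0 <-] rhoE] := ub_ereal_sup_adherent eps0 fE.
  by exists rho; split => //; rewrite -leeBlDr//; exact: ltW.
pose V := [set u : (R * R) * (R * R) | [/\ 0 < eucl_dist u.1 u.2,
  (1 + 2 * kap) * eucl_dist u.1 u.2 <= rho, 14 * eucl_dist u.1 u.2 <= d &
  (((1 + e0) * ((1 + 2 * kap) * eucl_dist u.1 u.2))%:E <
       hausdorff1 (E `&` two_disks kap u.1 u.2))%E]].
have [| |o [oV oB oK]] := @vitali_sequence R (R * R) _ V
   (fun u => two_disks kap u.1 u.2) (fun u => eucl_dist u.1 u.2) K.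
- by move=> u [].
- move=> s sV sdisj; rewrite -(@ler_pM2r _ (e0 * (1 + 2 * kap))) ?mulr_gt0// -/eps.
  have := @hausdorff1_bigsetU_le E rho eps _ s (fun u => two_disks kap u.1 u.2)
    (fun u => (1 + 2 * kap) * eucl_dist u.1 u.2) rho0 Efin Erho.
  have sw : {in s, forall u, (diam (two_disks kap u.1 u.2) <=
      ((1 + 2 * kap) * eucl_dist u.1 u.2)%:E)%E /\
      (1 + 2 * kap) * eucl_dist u.1 u.2 <= rho}.
    by move=> u /sV[_ ? _ _]; split => //; apply: diam_two_disks; exact: ltW.
  move=> /(_ (fun _ _ => two_disks_caratheodory _ _ _) sw).
  rewrite caratheodory_sum//; last by move=> *; exact: two_disks_caratheodory.
  have : ((\sum_(u <- s) (1 + e0) * ((1 + 2 * kap) * eucl_dist u.1 u.2))%:E <=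
      \sum_(u <- s) hausdorff1 (E `&` two_disks kap u.1 u.2))%E.
    rewrite -sumEFin !big_seq; apply: lee_sum => u /sV[_ _ _]; exact: ltW.
  move=> /le_trans /[apply]; rewrite -EFinD lee_fin -!mulr_sumr; lra.
(* If the disks of [(x, y)] meet those of a selected [(u, v)] at least half as long, the common
   point is within [2 * eucl_dist u v] of [u] and within twice that of [x]; hence 7 exceeds the
   required 6. *)
pose C n := oapp (fun u => disk (7 * eucl_dist u.1 u.2) u.1) set0 (o n).
have BadC : Bad `<=` \bigcup_n C n.
  move=> x [Ex Ed].
  have [|y [xy0]] := Ed (Num.min (rho / (1 + 2 * kap)) (d / 14)).
    by rewrite lt_min !divr_gt0.
  rewrite lt_min => /andP[]; rewrite !ltr_pdivlMr// => xyrho xyd xyE.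
  have [|n [[u v] [on]]] := oB (x, y); first by split => //=; lra.
  move=> /negP; rewrite /disj_set => /set0P[p [px pu]] /= xyuv; exists n => //.
  rewrite /C on /= /disk /=.
  have := eucl_dist_triangle p u x; have uv0 := eucl_dist_ge0 u v.
  have kuv : kap * eucl_dist u v <= eucl_dist u v by rewrite ler_piMl// ltW.
  have kxy : kap * eucl_dist x y <= eucl_dist x y by rewrite ler_piMl// ltW.
  have pu' : eucl_dist u p <= 2 * eucl_dist u v.
    case: pu; rewrite /disk /=; first by lra.
    by have := eucl_dist_triangle v u p; lra.
  have px' : eucl_dist p x <= 2 * eucl_dist x y.
    rewrite eucl_distC; case: px; rewrite /disk /=; first by lra.
    by have := eucl_dist_triangle y x p; lra.
  lra.
apply: le_trans (le_hausdorff1_pre _ BadC) _.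
apply: le_trans (hausdorff1_pre_sigma_subadditive d0 _) _.
apply: lime_le; first by apply: is_cvg_nneseries => *; exact: hausdorff1_pre_ge0.
apply: nearW => n; rewrite big_mkord.
apply: (@le_trans _ _ (\sum_(k < n)
    (14 * oapp (fun u => eucl_dist u.1 u.2) 0 (o k))%:E)%E); last first.
  rewrite sumEFin lee_fin -mulr_sumr; have := oK n; rewrite /K; lra.
apply: lee_sum => k _; rewrite /C; case ok : (o k) => [u|] /=; last first.
  by rewrite hausdorff1_pre0// mulr0.
have [u0 _ ud _] := oV _ _ ok.
have diamC : (diam (disk (7 * eucl_dist u.1 u.2) u.1) <= (14 * eucl_dist u.1 u.2)%:E)%E.
  apply: diam_le => [|p q]; first by lra.
  rewrite /disk /= => up uq; have := eucl_dist_triangle u.1 p q.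
  rewrite (eucl_distC p u.1); lra.
apply: le_trans (diamC); apply: hausdorff1_pre_diam => //.
by apply: le_trans diamC _; rewrite lee_fin.
Qed.

End convex_density.

(** * Minimal spanning trees and tours of finite point sets *)

Lemma seq_argmin {R : realType} {T : eqType} (f : T -> R) (s : seq T) : s != [::] ->
  exists2 x, x \in s & {in s, forall y : T, f x <= f y}.
Proof.
elim: s => // x [|y s] IH _.
  by exists x; rewrite ?mem_head// => z; rewrite inE => /eqP ->.
have [//|z zs zmin] := IH; have [xz|zx] := leP (f x) (f z).
  exists x; rewrite ?mem_head// => t; rewrite inE => /predU1P[->//|/zmin].
  exact: le_trans.
exists z; first by rewrite inE zs orbT.
by move=> t; rewrite inE => /predU1P[->|/zmin//]; exact: ltW.
Qed.

Section spanning_walk.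
Context {R : realType}.
Implicit Types (x y z : R * R) (s c w : seq (R * R)) (cs : seq (seq (R * R))).
Local Notation d := (@eucl_dist R).
Local Notation edge := ((R * R) * (R * R))%type.
Implicit Types (e : edge) (es : seq edge).

Definition edge_length e := d e.1 e.2.

Fixpoint walk_length x s : R :=
  if s is y :: s' then d x y + walk_length y s' else 0.

Definition tour_length s : R :=
  if s is x :: s' then walk_length x s' + d (last x s') x else 0.

Lemma walk_length_ge0 x s : 0 <= walk_length x s.
Proof. by elim: s x => //= y s IH x; rewrite addr_ge0 ?eucl_dist_ge0. Qed.

Lemma walk_length_cat x s y s' :
  walk_length x (s ++ y :: s') =
  walk_length x s + d (last x s) y + walk_length y s'.
Proof. by elim: s x => [|z s IH] x /=; rewrite ?add0r// IH !addrA. Qed.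

Lemma tour_length_catC s s' : tour_length (s ++ s') = tour_length (s' ++ s).
Proof.
case: s s' => [|x s] [|y s']; rewrite ?cats0//=.
rewrite !walk_length_cat !last_cat/=; ring.
Qed.

(** Rotate the tours to start at [x] and [y], with last points [u] and [u']. The closing edges from
    [u] to [x] and from [u'] to [y] are exchanged for edges from [u] to [y] and from [u'] to [x],
    each longer by at most [d x y]. *)
Lemma tour_merge c c' x y : x \in c -> y \in c' ->
  exists w, w =i c ++ c' /\
    tour_length w <= tour_length c + tour_length c' + 2 * d x y.
Proof.
move=> /path.splitPr[a b] /path.splitPr[a' b'].
exists ((x :: b ++ a) ++ (y :: b' ++ a')); split.
  by move=> z; rewrite !(mem_cat, inE); do ![case: (z \in _) | case: (_ == _)].
rewrite (tour_length_catC a) (tour_length_catC a')/= walk_length_cat !last_cat/= last_cat.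
set u := last (last x b) a; set u' := last (last y b') a'.
have := eucl_dist_triangle x u y; have := eucl_dist_triangle y u' x.
by rewrite (eucl_distC y x); lra.
Qed.

(* With [c] a single point and [u = v], this says that the point is outside the
   open lens of [e]. *)
Definition separates c e : Prop :=
  forall u v, u \in c -> v \in c ->
    ~ (d u e.1 < edge_length e /\ d v e.2 < edge_length e).

(** In Kruskal's order [e] is merged before [e'], so its two ends already share a cluster when [e']
    is chosen, and [separates] gives this relation. It keeps edges, seen as points of the fourfold
    product of [R], from crowding. *)
Definition apart e e' : bool :=
  ~~ ((d e.1 e'.1 < edge_length e') && (d e.2 e'.2 < edge_length e')).

(** Take a shortest edge between two clusters. If one cluster came closer than its length to both
    ends, that cluster would differ from at least one of the two joined clusters and yield a shorter
    edge. *)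
Lemma closest_clusters cs c0 c0' cs0 : cs = c0 :: c0' :: cs0 ->
  {in cs, forall c, c != [::]} ->
  exists e c c' cs', [/\ perm_eq cs (c :: c' :: cs'), e.1 \in c, e.2 \in c' &
    {in cs, forall c, separates c e}].
Proof.
move=> csE ne.
(* Distinct clusters means distinct positions in [cs], which [perm_eq] expresses even if the lists
   coincide. *)
pose cand e := exists c c' cs', [/\ perm_eq cs (c :: c' :: cs'), e.1 \in c & e.2 \in c'].
have cand_flatten e : cand e -> e.1 \in flatten cs /\ e.2 \in flatten cs.
  move=> [c [c' [cs' [/perm_mem csp ec ec']]]].
  split; apply/flattenP; [exists c|exists c'] => //;
    by rewrite csp !inE eqxx ?orbT.
have [|e] := @seq_argmin R _ edge_length
    [seq e <- [seq (x, y) | x <- flatten cs, y <- flatten cs] | `[< cand e >]].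
  have [x xc0] : exists x, x \in c0.
    have := ne c0; rewrite csE mem_head => /(_ isT); case: (c0) => // x s _.
    by exists x; rewrite mem_head.
  have [y yc0] : exists y, y \in c0'.
    have := ne c0'; rewrite csE !inE eqxx orbT => /(_ isT).
    by case: (c0') => // y s _; exists y; rewrite mem_head.
  have cxy : cand (x, y) by exists c0, c0', cs0; rewrite csE.
  rewrite -has_filter; apply/hasP; exists (x, y); last exact/asboolP.
  by have [] := cand_flatten _ cxy => xs ys; apply/allpairsP; exists (x, y).
rewrite mem_filter => /andP[/asboolP[c [c' [cs' [csp ec ec']]]] _] emin.
have cmin e' : cand e' -> edge_length e <= edge_length e'.
  move=> ce'; apply: emin; rewrite mem_filter; apply/andP; split; first exact/asboolP.
  have [e1 e2] := cand_flatten _ ce'.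
  by apply/allpairsP; exists e'; rewrite -surjective_pairing.
exists e, c, c', cs'; split => // c1; rewrite (perm_mem csp) !inE => c1E.
move=> u v uc vc [ue ve].
have [e'] : exists2 e', cand e' & edge_length e' < edge_length e; last first.
  by move=> /cmin; rewrite leNgt => /negP nlt /nlt.
move: c1E => /or3P[/eqP c1E|/eqP c1E|c1cs'].
- by subst c1; exists (v, e.2) => //; exists c, c', cs'.
- subst c1; exists (e.1, u); last by rewrite /edge_length eucl_distC.
  by exists c, c', cs'.
- exists (u, e.1) => //; exists c1, c, (c' :: rem c1 cs'); split => //.
  rewrite (perm_trans csp)//; apply: (@perm_trans _ (c :: c' :: c1 :: rem c1 cs')).
    by rewrite !perm_cons perm_to_rem.
  exact: (permEl (perm_catCA [:: c; c'] [:: c1] (rem c1 cs'))).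
Qed.

Definition spanning_data cs w es : Prop :=
  [/\ {subset flatten cs <= w},
      tour_length w <= \sum_(c <- cs) tour_length c + 2 * \sum_(e <- es) edge_length e,
      {in es, forall e, [/\ e.1 \in flatten cs, e.2 \in flatten cs &
                            {in cs, forall c, separates c e}]}
    & pairwise apart es].

(* Kruskal's algorithm: the clusters are tours, merged along a closest pair. *)
Lemma kruskal cs : cs != [::] -> {in cs, forall c, c != [::]} ->
  exists w es, spanning_data cs w es.
Proof.
have [n] := ubnP (size cs); elim: n cs => // n IH [//|c0 [|c0' cs0]] csn _ ne.
  exists c0, [::]; split => //=; first by rewrite cats0.
  by rewrite big_seq1 big_nil mulr0 addr0.
move csE : (c0 :: c0' :: cs0) csn ne => cs csn ne.
have [e [c [c' [cs' [csp ec ec' esep]]]]] := closest_clusters (esym csE) ne.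
have [w0 [w0E w0_len]] := tour_merge ec ec'.
have [|||w [es [wsub wlen esP esR]]] := IH (w0 :: cs').
- by move: csn; rewrite (perm_size csp) /= !ltnS.
- by [].
- move=> c1; rewrite inE => /predU1P[->|c1cs'].
    by apply/eqP => w00; have := w0E e.1; rewrite w00 mem_cat ec.
  by apply: ne; rewrite (perm_mem csp) !inE c1cs' !orbT.
have fE x : (x \in flatten cs) = (x \in flatten (w0 :: cs')).
  by rewrite (perm_mem (perm_flatten csp)) /= !mem_cat w0E mem_cat orbA.
exists w, (e :: es); split.
- by move=> x; rewrite fE; exact: wsub.
- rewrite (perm_big _ csp) /= !big_cons; move: wlen; rewrite big_cons.
  by rewrite -/(edge_length e) in w0_len; lra.
- move=> e1; rewrite inE => /predU1P[->|e1es].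
    split => //; apply/flattenP; [exists c|exists c'] => //;
      by rewrite (perm_mem csp) !inE eqxx ?orbT.
  have [e11 e12 e1sep] := esP _ e1es; rewrite !fE; split => // c1.
  (* Later edges separate the merged cluster [w0], hence also its two parts [c] and [c']. *)
  rewrite (perm_mem csp) !inE => /or3P[/eqP->|/eqP->|c1cs'].
  + move=> u v uc vc; apply: (e1sep w0); rewrite ?mem_head//.
      by rewrite w0E mem_cat uc.
    by rewrite w0E mem_cat vc.
  + move=> u v uc vc; apply: (e1sep w0); rewrite ?mem_head//.
      by rewrite w0E mem_cat uc orbT.
    by rewrite w0E mem_cat vc orbT.
  + by apply: e1sep; rewrite inE c1cs' orbT.
- rewrite pairwise_cons esR andbT; apply/allP => e1 /esP[_ _ e1sep].
  apply/negP => /andP[d1 d2]; apply: (e1sep w0 _ e.1 e.2) => //.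
  + by rewrite mem_head.
  + by rewrite w0E mem_cat ec.
  + by rewrite w0E mem_cat ec' orbT.
Qed.

(** [tau] is the arc length along the walk at the first visit of a point; a chord is never longer
    than the arc. *)
Lemma walk_parametrization x s : exists tau : R * R -> R,
  [/\ tau x = 0, {in x :: s, forall y, 0 <= tau y <= walk_length x s} &
      {in x :: s &, forall y z, d y z <= `|tau y - tau z|}].
Proof.
elim: s x => [|y s IH] x.
  exists (fun=> 0); split => // [y _|y z]; first by rewrite /= lexx.
  by rewrite !inE => /eqP-> /eqP->; rewrite eucl_distxx.
have [tau [tauy tau_ge tauP]] := IH y.
pose tau' z := if z == x then 0 else d x y + tau z.
have tau'x z : z \in y :: s -> d x z <= d x y + tau z.
  move=> zs; have := tauP y z (mem_head _ _) zs; rewrite tauy sub0r normrN.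
  have /andP[tz _] := tau_ge z zs; rewrite ger0_norm//.
  by have := eucl_dist_triangle y x z; lra.
have ts z : z \in x :: y :: s -> z != x -> z \in y :: s.
  by rewrite inE => /predU1P[->|//]; rewrite eqxx.
exists tau'; split => [|z zs|z t zs ts']; rewrite /tau'.
- by rewrite eqxx.
- case: ifPn => [_|/(ts _ zs)/tau_ge/andP[z0 z1] /=].
    by rewrite lexx/= addr_ge0 ?eucl_dist_ge0 ?walk_length_ge0.
  by rewrite addr_ge0 ?eucl_dist_ge0//= lerD2l.
- case: ifPn => [/eqP->|zx]; case: ifPn => [/eqP->|tx].
  + by rewrite eucl_distxx.
  + rewrite sub0r normrN; apply: le_trans (ler_norm _); exact/tau'x/ts.
  + rewrite subr0 eucl_distC; apply: le_trans (ler_norm _); exact/tau'x/ts.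
  + by rewrite opprD addrACA subrr add0r; apply: tauP; exact: ts.
Qed.

End spanning_walk.

(** Keep a heaviest [x] and discard all that meets it: at most [M] elements, [x] included, each of
    weight at most [w x]. Then repeat. *)
Lemma greedy_disjoint {R : realType} {T : eqType} (w : T -> R) (meets : rel T)
    (M : nat) (s : seq T) :
  (forall x, 0 <= w x) -> {in s, forall x, meets x x} ->
  (forall x, x \in s -> (count (fun y => (w y <= w x)%R && meets x y) s <= M)%N) ->
  exists t, [/\ {subset t <= s}, pairwise (fun x y => ~~ meets x y) t &
    \sum_(x <- s) w x <= M%:R * \sum_(x <- t) w x].
Proof.
move=> w0; have [n] := ubnP (size s); elim: n s => // n IH s sn srefl sM.
have [->|s0] := eqVneq s [::].
  by exists [::]; split => //; rewrite !big_nil mulr0.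
have [x xs xmax] := seq_argmin (fun y => - w y) s0.
pose s' := [seq y <- s | ~~ meets x y].
have s's : {subset s' <= s} by move=> y; rewrite mem_filter => /andP[].
have [|||t [ts tdisj tsum]] := IH s'.
- rewrite ltnS in sn; apply: leq_trans sn.
  rewrite size_filter -(count_predC (meets x) s) -[X in (X < _)%N]add0n ltn_add2r.
  by rewrite -has_count; apply/hasP; exists x => //; exact: srefl.
- by move=> y /s's; exact: srefl.
- move=> y /s's/sM; apply: leq_trans.
  by apply: leq_count_subseq; exact: filter_subseq.
exists (x :: t); split.
- by move=> y; rewrite inE => /predU1P[->//|/ts/s's].
- rewrite pairwise_cons tdisj andbT; apply/allP => y /ts.
  by rewrite mem_filter => /andP[].
- rewrite (bigID (meets x))/= big_cons mulrDr; apply: lerD; last first.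
    by rewrite -big_filter.
  apply: (@le_trans _ _ (\sum_(y <- s | meets x y) w x)).
    rewrite big_seq_cond [leRHS]big_seq_cond; apply: ler_sum => y /andP[/xmax].
    by rewrite lerN2.
  rewrite big_const_seq iter_addr_0 -[w x *+ _]mulr_natl ler_wpM2r// ler_nat.
  apply: leq_trans (sM x xs); rewrite leq_eqVlt; apply/orP; left; apply/eqP.
  by apply: eq_in_count => y /xmax; rewrite lerN2 => ->.
Qed.

(** * Packing of lenses and the length of the spanning tree *)

Section lens_packing.
Context {R : realType}.
Implicit Types (x y z : R * R) (E : set (R * R)) (N : seq (R * R)).
Local Notation d := (@eucl_dist R).
Local Notation edge := ((R * R) * (R * R))%type.
Implicit Types (e : edge) (es : seq edge).

Definition lens (kap : R) e : set (R * R) :=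
  disk (kap * edge_length e) e.1 `&` disk (kap * edge_length e) e.2.

(* A square of side [4 r] is cut into cells of side [eta * r / 4]. *)
Definition packing_side (eta : R) : nat := (Num.trunc (16 / eta)).+1.

(** Pigeonhole on the four coordinates of the two ends: edges with the same four cells have
    corresponding ends closer than [eta * r], which is less than their lengths, against [apart]. *)
Lemma packing_bound (eta : R) e es : 0 < eta -> 0 < edge_length e ->
  pairwise apart es ->
  {in es, forall e', [/\ eta * edge_length e < edge_length e',
    d e.1 e'.1 <= 2 * edge_length e & d e.1 e'.2 <= 2 * edge_length e]} ->
  (size es <= packing_side eta ^ 4)%N.
Proof.
move=> eta0; set r := edge_length e => r0 esR esP; set k := packing_side eta.
(* The shift by [2 * r] puts the numerator between 0 and [4 * r], so the index is below [k] and
   [inord] does not fall back to its default. *)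
pose cell (a b : R) : 'I_k := inord (Num.trunc ((b - a + 2 * r) / (eta * r / 4))).
have h0 : 0 < eta * r / 4 by rewrite !mulr_gt0// invr_gt0.
have cellP a b b' : `|a - b| <= 2 * r -> `|a - b'| <= 2 * r ->
    cell a b = cell a b' -> `|b - b'| < eta * r / 4.
  have idx c : `|a - c| <= 2 * r -> 0 <= (c - a + 2 * r) / (eta * r / 4) /\
      nat_of_ord (cell a c) = Num.trunc ((c - a + 2 * r) / (eta * r / 4)).
    rewrite ler_norml => /andP[c1 c2].
    have t0 : 0 <= (c - a + 2 * r) / (eta * r / 4).
      by apply: divr_ge0; [lra|exact: ltW].
    split => //; rewrite inordK// ltnS; apply: le_truncn.
    rewrite ler_pdivrMr//; have -> : 16 / eta * (eta * r / 4) = 4 * r.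
      by field; rewrite gt_eqF.
    lra.
  move=> /idx[t0 tE] /idx[t0' tE'] /(congr1 (@nat_of_ord _)); rewrite tE tE' => tt'.
  have /andP[u1 u2] := truncn_itv t0; have /andP[v1 v2] := truncn_itv t0'.
  rewrite tt' in u1 u2.
  have : `|(b - a + 2 * r) / (eta * r / 4) - (b' - a + 2 * r) / (eta * r / 4)| < 1.
    move: u1 u2 v1 v2; rewrite -natr1 ltr_norml; set m := (Num.trunc _)%:R.
    by move=> u1 u2 v1 v2; apply/andP; split; lra.
  rewrite -mulrBl normrM normfV (gtr0_norm h0) ltr_pdivrMr// mul1r.
  by have -> : b - a + 2 * r - (b' - a + 2 * r) = b - b' by ring.
have near z z' : d e.1 z <= 2 * r -> d e.1 z' <= 2 * r ->
    cell e.1.1 z.1 = cell e.1.1 z'.1 -> cell e.1.2 z.2 = cell e.1.2 z'.2 ->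
    d z z' < eta * r.
  move=> ez ez' c1 c2; apply: le_lt_trans (eucl_dist_le_sum _ _) _.
  have := cellP _ _ _ (le_trans (le_eucl_dist1 _ _) ez)
    (le_trans (le_eucl_dist1 _ _) ez') c1.
  have := cellP _ _ _ (le_trans (le_eucl_dist2 _ _) ez)
    (le_trans (le_eucl_dist2 _ _) ez') c2.
  lra.
pose f e' := (cell e.1.1 e'.1.1, cell e.1.2 e'.1.2,
              (cell e.1.1 e'.2.1, cell e.1.2 e'.2.2)).
have funiq : uniq (map f es).
  rewrite uniq_pairwise pairwise_map.
  apply: (sub_in_pairwise (P := mem es)) esR; last exact/allP.
  move=> e1 e2 /esP[_ e11 e12] /esP[re2 e21 e22]; apply: contraNneq => -[c1 c2 c3 c4].
  by rewrite !(lt_trans (near _ _ _ _ _ _) re2).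
rewrite -(size_map f) -(card_uniqP funiq); apply: leq_trans (max_card _) _.
by rewrite !card_prod !card_ord -!mulnA !expnS expn0 muln1.
Qed.

(* A lens shrunk by the factor [1 - eta] stays at distance [eta] times its size
   from the points of [N], so that two such lenses can only meet if they are of
   comparable size, and then the packing bound applies. *)
Lemma lens_family_length E N es (eta c : R) :
  0 < eta -> eta < 1 -> 0 < c -> (hausdorff1 E < +oo)%E ->
  {in es, forall e, [/\ e.1 \in N, e.2 \in N &
    {in N, forall z, ~ (d z e.1 < edge_length e /\ d z e.2 < edge_length e)}]} ->
  pairwise apart es ->
  {in es, forall e,
    ((c * edge_length e)%:E <= hausdorff1 (E `&` lens (1 - eta) e))%E} ->
  c * \sum_(e <- es) edge_length e <=
    (packing_side eta ^ 4)%:R * fine (hausdorff1 E).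
Proof.
move=> eta0 eta1 c0 Efin esN esR esE.
pose es0 := [seq e <- es | 0 < edge_length e].
have es0P : {subset es0 <= es} by move=> e; rewrite mem_filter => /andP[].
have -> : \sum_(e <- es) edge_length e = \sum_(e <- es0) edge_length e.
  rewrite (bigID (fun e => 0 < edge_length e))/= [X in _ + X]big1 ?addr0 ?big_filter//.
  by move=> e; rewrite -leNgt => e0; apply/eqP; rewrite eq_le e0 eucl_dist_ge0.
(* The first alternative ensures reflexivity: a lens with [1 - eta <= 1 / 2] is empty and so
   disjoint from itself. *)
pose meets e e' := (e' == e) || ~~ disj_set (lens (1 - eta) e) (lens (1 - eta) e').
have [| | |t [ts tdisj tsum]] := @greedy_disjoint R _ edge_length meets
    (packing_side eta ^ 4) es0.
- by move=> e; exact: eucl_dist_ge0.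
- by move=> e _; rewrite /meets eqxx.
- move=> e ees0; have e0 : 0 < edge_length e.
    by move: ees0; rewrite mem_filter => /andP[].
  have [eN1 eN2 eN] := esN _ (es0P _ ees0).
  rewrite -size_filter; apply: (@packing_bound eta e) => //.
    apply: subseq_pairwise esR.
    exact: subseq_trans (filter_subseq _ _) (filter_subseq _ _).
  move=> e'; rewrite mem_filter => /andP[/andP[le' me'] /es0P e'es].
  have [e'N1 e'N2 _] := esN _ e'es.
  move: me' => /predU1P[->|].
    rewrite -/(edge_length e) eucl_distxx.
    by split; [rewrite gtr_pMl|lra|rewrite -/(edge_length e); lra].
  move=> /set0P[p [[p1 p2] [p1' p2']]]; rewrite /disk /= in p1 p2 p1' p2'.
  have e'0 := eucl_dist_ge0 e'.1 e'.2; rewrite -/(edge_length e') in e'0.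
  have h1 : (1 - eta) * edge_length e' <= edge_length e' by rewrite ler_piMl//; lra.
  have h2 : (1 - eta) * edge_length e <= edge_length e by rewrite ler_piMl//; lra.
  split.
  + rewrite ltNge; apply/negP => ee'; apply: (eN e'.1 e'N1).
    have := eucl_dist_triangle p e'.1 e.1; have := eucl_dist_triangle p e'.1 e.2.
    by rewrite (eucl_distC p e.1) (eucl_distC p e.2); split; lra.
  + by have := eucl_dist_triangle p e.1 e'.1; rewrite (eucl_distC p e'.1); lra.
  + by have := eucl_dist_triangle p e.1 e'.2; rewrite (eucl_distC p e'.2); lra.
have fE : hausdorff1 E \is a fin_num by rewrite ge0_fin_numE// outer_measure_ge0.
have tE : c * \sum_(e <- t) edge_length e <= fine (hausdorff1 E).
  rewrite -lee_fin fineK// mulr_sumr -sumEFin.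
  apply: (@le_trans _ _ (\sum_(e <- t) hausdorff1 (E `&` lens (1 - eta) e))%E).
    by rewrite !big_seq; apply: lee_sum => e /ts/es0P/esE.
  rewrite -(@caratheodory_sum _ _ (@hausdorff1 R)).
  - by apply: (le_outer_measure (@hausdorff1 R)); exact: subIsetl.
  - by move=> e _; apply: (@caratheodory_measurable_setI _ _ (@hausdorff1 R));
      exact: disk_caratheodory.
  - apply: sub_pairwise tdisj => e e'; rewrite /meets negb_or => /andP[_].
    by rewrite negbK.
apply: le_trans (ler_wpM2l (ltW c0) tsum) _.
by rewrite mulrCA ler_wpM2l// ler0n.
Qed.

(** Kruskal's algorithm starts from singletons, whose tours have length 0, so the final tour is at
    most twice the tree. The bound on [tau] is independent of [N], as the compactness argument
    requires. *)
Lemma short_parametrization E N (eta c : R) :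
  0 < eta -> eta < 1 -> 0 < c -> (hausdorff1 E < +oo)%E ->
  {in N &, forall x y,
    ((c * d x y)%:E <= hausdorff1 (E `&` lens (1 - eta) (x, y)))%E} ->
  exists tau : R * R -> R,
    {in N, forall x, 0 <= tau x <=
       2 * ((packing_side eta ^ 4)%:R * fine (hausdorff1 E) / c)} /\
    {in N &, forall x y, d x y <= `|tau x - tau y|}.
Proof.
move=> eta0 eta1 c0 Efin NE.
have [->|N0] := eqVneq N [::]; first by exists (fun=> 0); split.
pose cs := [seq [:: x] | x <- N].
have csN : flatten cs = N by exact: flatten_seq1.
have [||w [es [wsub wlen esP esR]]] := @kruskal R cs.
- by rewrite /cs; case: (N) N0.
- by move=> ? /mapP[x _ ->].
have wes : tour_length w <= 2 * \sum_(e <- es) edge_length e.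
  apply: le_trans wlen _; rewrite big_map big1 ?add0r// => x _.
  by rewrite /= eucl_distxx addr0.
have esN : {in es, forall e, [/\ e.1 \in N, e.2 \in N &
    {in N, forall z, ~ (d z e.1 < edge_length e /\ d z e.2 < edge_length e)}]}.
  move=> e /esP[]; rewrite csN => e1 e2 esep; split => // z zN.
  by apply: (esep [:: z]); rewrite ?mem_head//; apply/mapP; exists z.
have := @lens_family_length E N es eta c eta0 eta1 c0 Efin esN esR.
have esE : {in es, forall e,
    ((c * edge_length e)%:E <= hausdorff1 (E `&` lens (1 - eta) e))%E}.
  by move=> e /esN[e1 e2 _]; rewrite [e in lens _ e]surjective_pairing; exact: NE.
move=> /(_ esE); rewrite mulrC -ler_pdivlMr// => esL.
case: w wsub wes {wlen} => [wsub|x s wsub wes].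
  by move: N0 wsub; rewrite csN; case: (N) => // y N' _ /(_ y);
     rewrite mem_head => /(_ isT).
have [tau [_ tau_ge tauP]] := walk_parametrization x s.
exists tau; split => [y yN|y z yN zN]; last by apply: tauP; apply: wsub; rewrite csN.
have /andP[-> tL] /= : 0 <= tau y <= walk_length x s.
  by apply: tau_ge; apply: wsub; rewrite csN.
apply: le_trans tL _; rewrite /= in wes.
by have := eucl_dist_ge0 (last x s) x; lra.
Qed.

End lens_packing.

(** * Compactness and Lipschitz extension *)

Lemma fmap_ultra {T U : Type} (f : T -> U) (F : set_system T) :
  UltraFilter F -> UltraFilter (f @ F).
Proof.
move=> FU; split => [|G GP FG]; first exact: fmap_proper_filter.
apply/seteqP; split => // S GS; have [//|FS] := in_ultra_setVsetC (f @^-1` S) FU.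
have : G (S `&` ~` S) by apply: filterI => //; exact: FG.
by rewrite setICr => /filter_not_empty.
Qed.

(** The hypothesis makes [g] a 1-Lipschitz function of [tau]; McShane's formula extends it by the
    infimum over [x] in [A] of [g x] plus the distance from [t] to [tau x]. *)
Lemma mcshane {R : realType} {T : Type} (A : set T) (tau g : T -> R) :
  (forall x y, A x -> A y -> `|g x - g y| <= `|tau x - tau y|) ->
  exists2 h : R -> R, forall s t, `|h s - h t| <= `|s - t| &
    forall x, A x -> h (tau x) = g x.
Proof.
move=> gtau; have [[x0 Ax0]|A0] := pselect (A !=set0); last first.
  exists (fun=> 0) => [s t|x Ax]; first by rewrite subrr normr0.
  by case: A0; exists x.
pose S t := [set g x + `|t - tau x| | x in A].
have S_lb t x : A x -> lbound (S t) (g x - `|t - tau x|).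
  move=> Ax _ [y Ay <-]; have := gtau x y Ax Ay.
  rewrite ler_norml => /andP[_]; have := ler_distD t (tau x) (tau y).
  by rewrite (distrC (tau x) t); lra.
have S0 t : S t !=set0 by exists (g x0 + `|t - tau x0|), x0.
have S_has t : has_lbound (S t) by exists (g x0 - `|t - tau x0|); exact: S_lb.
have hst s t : inf (S s) <= inf (S t) + `|s - t|.
  rewrite -lerBlDr; apply: lb_le_inf => // _ [x Ax <-].
  have : inf (S s) <= g x + `|s - tau x| by apply: ge_inf => //; exists x.
  by have := ler_distD t s (tau x); lra.
exists (inf \o S) => [s t|x Ax] /=.
  rewrite ler_norml; apply/andP; split.
    by have := hst t s; rewrite distrC; lra.
  by have := hst s t; lra.
apply/eqP; rewrite eq_le; apply/andP; split.
  by apply: ge_inf => //; exists x; rewrite // subrr normr0 addr0.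
apply: lb_le_inf => //; have := S_lb (tau x) x Ax.
by rewrite subrr normr0 subr0.
Qed.

Section compactness_extension.
Context {R : realType}.
Implicit Types (x y : R * R) (A : set (R * R)) (N : seq (R * R)).

(* The limit is taken along an ultrafilter on the finite subsets of [A] that
   contains all the cones [N0 `<=` N]. *)
Lemma parametrization_compactness A (L : R) :
  (forall N, {in N, forall x, A x} -> exists tau : R * R -> R,
     {in N, forall x, 0 <= tau x <= L} /\
     {in N &, forall x y, eucl_dist x y <= `|tau x - tau y|}) ->
  exists tau : R * R -> R,
    forall x y, A x -> A y -> eucl_dist x y <= `|tau x - tau y|.
Proof.
move=> AN.
have /choice[t tP] N : exists tau : R * R -> R, {in N, forall x, A x} ->
     {in N, forall x, 0 <= tau x <= L} /\
     {in N &, forall x y, eucl_dist x y <= `|tau x - tau y|}.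
  have [NA|NA] := pselect {in N, forall x, A x}; last by exists (fun=> 0).
  by have [tau tauP] := AN N NA; exists tau.
pose F : set_system (seq (R * R)) := [set S |
  exists2 N0 : seq (R * R), {in N0, forall x, A x} &
  forall N, {in N, forall x, A x} -> {subset N0 <= N} -> S N].
have FF : ProperFilter F.
  split; first by move=> [N0 N0A /(_ N0 N0A)]; apply.
  split => [|S S' [N1 A1 N1S] [N2 A2 N2S]|S S' SS' [N1 A1 N1S]].
  - by exists [::].
  - exists (N1 ++ N2).
      by move=> x; rewrite mem_cat => /orP[/A1|/A2].
    move=> N NA N12; split; [apply: N1S|apply: N2S] => // x xN; apply: N12;
      by rewrite mem_cat xN ?orbT.
  - by exists N1 => // N NA N1N; apply: SS'; exact: N1S.
have [U [UU FU]] := ultraFilterLemma FF.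
have Ux x : A x -> U [set N : seq (R * R) | x \in N /\ {in N, forall y, A y}].
  move=> Ax; apply: FU; exists [:: x] => [y|N NA xN].
    by rewrite inE => /eqP ->.
  by split => //; apply: xN; rewrite mem_head.
have /choice[tau tauP] x : exists l : R, A x -> t N x @[N --> U] --> l.
  have [Ax|Ax] := pselect (A x); last by exists 0.
  (* Eventually along [U] the set [N] contains [x], so [t N x] lies in the segment from 0 to [L] and
     converges. *)
  have := @segment_compact R 0 L; rewrite compact_ultra => cmp.
  have [|l [_ xl]] := cmp _ (fmap_ultra (t ^~ x) UU); last by exists l.
  suff : U ((t ^~ x) @^-1` `[0, L]) by [].
  have := Ux x Ax; apply: filterS => N [xN NA] /=.
  by rewrite in_itv/=; exact: (tP N NA).1.
exists tau => x y Ax Ay.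
have /cvg_norm txy : (t N x - t N y) @[N --> U] --> tau x - tau y.
  by apply: cvgB; exact: tauP.
apply: (cvgr_to_ge txy); have := Ux y Ay; have := Ux x Ax.
apply: filterS2 => N [xN NA] [yN _].
exact: (tP N NA).2.
Qed.

(** The inverse of [tau] is 1-Lipschitz on the image of [A]; its two coordinates are extended
    separately, at the price of the constant 2. *)
Lemma lipschitz_cover A (tau : R * R -> R) :
  (forall x y, A x -> A y -> eucl_dist x y <= `|tau x - tau y|) ->
  exists f : R -> R * R, eucl_lipschitz f /\ A `<=` range f.
Proof.
move=> Atau.
have [|h1 h1L h1A] := @mcshane R _ A tau fst.
  by move=> x y Ax Ay; exact: le_trans (le_eucl_dist1 _ _) (Atau _ _ Ax Ay).
have [|h2 h2L h2A] := @mcshane R _ A tau snd.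
  by move=> x y Ax Ay; exact: le_trans (le_eucl_dist2 _ _) (Atau _ _ Ax Ay).
exists (fun t => (h1 t, h2 t)); split.
  exists 2 => s t; apply: le_trans (eucl_dist_le_sum _ _) _ => /=.
  by have := h1L s t; have := h2L s t; lra.
by move=> x Ax; exists (tau x) => //; rewrite h1A// h2A// -surjective_pairing.
Qed.

End compactness_extension.

(** * Rectifiability for lower densities above 3/4 *)

Section rectifiability.
Context {R : realType}.
Implicit Types (x y : R * R) (E : set (R * R)).

(** Inclusion and exclusion for the two disks, obtained by splitting along the first one. *)
Lemma lens_measure_ge E (kap a b : R) x y : (hausdorff1 E < +oo)%E ->
  (a%:E <= hausdorff1 (E `&` disk (kap * eucl_dist x y) x))%E ->
  (a%:E <= hausdorff1 (E `&` disk (kap * eucl_dist x y) y))%E ->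
  (hausdorff1 (E `&` two_disks kap x y) <= b%:E)%E ->
  ((2 * a - b)%:E <= hausdorff1 (E `&` lens kap (x, y)))%E.
Proof.
move=> Efin; rewrite /lens /two_disks /edge_length /=.
set B := disk _ x; set B' := disk _ y.
have mB : (@hausdorff1 R).-caratheodory B by exact: disk_caratheodory.
have le_H := le_outer_measure (@hausdorff1 R).
have fin A : A `<=` E -> exists v, hausdorff1 A = v%:E.
  move=> AE; exists (fine (hausdorff1 A)).
  rewrite fineK// ge0_fin_numE ?outer_measure_ge0//.
  exact: le_lt_trans (le_H _ _ AE) Efin.
rewrite (mB (E `&` B')) (mB (E `&` (B `|` B'))).
have -> : E `&` (B `|` B') `&` B = E `&` B.
  by apply/seteqP; split => z; [move=> [[]]|move=> [? ?]; split => //; split => //; left].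
have -> : E `&` (B `|` B') `&` ~` B = E `&` B' `&` ~` B.
  apply/seteqP; split => z; first by move=> [[Ez [Bz|Bz]] nBz]; split.
  by move=> [[Ez B'z] nBz]; split => //; split => //; right.
have -> : E `&` B' `&` B = E `&` (B `&` B') by rewrite -setIA (setIC B').
have [u ->] := fin (E `&` B) (@subIsetl _ _ _).
have [v ->] := fin (E `&` (B `&` B')) (@subIsetl _ _ _).
have [w ->] := fin (E `&` B' `&` ~` B) (subset_trans (@subIsetl _ _ _) (@subIsetl _ _ _)).
rewrite -!EFinD !lee_fin; lra.
Qed.

Lemma lower_density_gt E x (a : R) : (a%:E < lower_density E x)%E ->
  exists2 e, 0 < e & forall r, 0 < r -> r < e ->
    ((2 * a * r)%:E <= hausdorff1 (E `&` disk r x))%E.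
Proof.
rewrite /lower_density limf_einfE => /ereal_sup_gt[_ [V V0 <-] aV].
have [e /= e0 eV] := V0; exists e => // r r0 re.
have Vr : V r by apply: eV => //=; rewrite sub0r normrN gtr0_norm.
have /ltW := lt_le_trans aV (ereal_inf_lbound (ex_intro2 _ _ r Vr erefl)).
rewrite lee_pdivlMr ?mulr_gt0// -EFinM setIC.
by have -> : a * (2 * r) = 2 * a * r by ring.
Qed.

Lemma rectifiability_threshold_gt (s : R) : 3 / 4 < s -> rectifiability_threshold s.
Proof.
move=> s34 E _ Efin Enull.
pose b : R := Num.min (1 / 4) ((s - 3 / 4) / 2).
have b0 : 0 < b by rewrite lt_min; apply/andP; split; lra.
have b1 : b <= 1 / 4 by rewrite ge_min lexx.
have bs : 3 / 4 + b < s.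
  have : b <= (s - 3 / 4) / 2 by rewrite ge_min lexx orbT.
  lra.
pose eta := b / 2; pose kap := 1 - eta.
(* The mass of the two disks minus the bound for their union, per unit of distance. Both terms are 3
   at [b = 0], whence the value 3/4; in general [c = 2 * b - 3 / 2 * b ^+ 2]. *)
pose c := 4 * (3 / 4 + b) * kap - (1 + eta) * (1 + 2 * kap).
have eta0 : 0 < eta by rewrite /eta; lra.
have eta1 : eta < 1 by rewrite /eta; lra.
have kap0 : 0 < kap by rewrite /kap; lra.
have kap1 : kap < 1 by rewrite /kap; lra.
have c0 : 0 < c by rewrite /c /kap /eta; nra.
pose En (n : nat) := [set x | [/\ E x,
  forall r, 0 < r -> r < n.+1%:R^-1 ->
    ((2 * (3 / 4 + b) * r)%:E <= hausdorff1 (E `&` disk r x))%E &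
  forall y, 0 < eucl_dist x y -> eucl_dist x y < n.+1%:R^-1 ->
    (hausdorff1 (E `&` two_disks kap x y) <=
     ((1 + eta) * ((1 + 2 * kap) * eucl_dist x y))%:E)%E]].
(* Grid squares of side [(4 * n.+1%:R)^-1] keep the points of a cell closer than the scale
   [n.+1%:R^-1] at which the estimates of [En n] hold. *)
pose cell (i : nat * int * int) := [set x | [/\ En i.1.1 x,
  Num.floor (x.1 * (4 * i.1.1.+1%:R)) = i.1.2 &
  Num.floor (x.2 * (4 * i.1.1.+1%:R)) = i.2]].
have cell_lipschitz i : exists f : R -> R * R, eucl_lipschitz f /\ cell i `<=` range f.
  pose n := i.1.1; have n0 : 0 < n.+1%:R :> R by [].
  have cell_dist x y : cell i x -> cell i y -> eucl_dist x y < n.+1%:R^-1.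
    move=> [_ x1 x2] [_ y1 y2]; apply: le_lt_trans (eucl_dist_le_sum _ _) _.
    have floor_near (p q : R) :
        Num.floor (p * (4 * n.+1%:R)) = Num.floor (q * (4 * n.+1%:R)) ->
        `|p - q| < n.+1%:R^-1 / 4.
      move=> pq; have := floor_itv (p * (4 * n.+1%:R)).
      have := floor_itv (q * (4 * n.+1%:R)); rewrite pq intrD.
      move=> /andP[q1 q2] /andP[p1 p2].
      have -> : n.+1%:R^-1 / 4 = (4 * n.+1%:R)^-1 :> R by rewrite invfM mulrC.
      rewrite -[ltRHS]mul1r ltr_pdivlMr ?mulr_gt0//.
      rewrite -{1}(gtr0_norm (mulr_gt0 (ltr0n _ 4) n0)) -normrM mulrBl.
      by rewrite ltr_norml; apply/andP; split; lra.
    have h1 := floor_near x.1 y.1 (etrans x1 (esym y1)).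
    have h2 := floor_near x.2 y.2 (etrans x2 (esym y2)).
    have : 0 < n.+1%:R^-1 :> R by rewrite invr_gt0.
    by move: h1 h2; move: (n.+1%:R^-1) => m; lra.
  have [|tau tauP] := @parametrization_compactness R (cell i)
    (2 * ((packing_side eta ^ 4)%:R * fine (hausdorff1 E) / c));
    last exact: lipschitz_cover tauP.
  move=> N NA; apply: short_parametrization => // x y /NA Ax /NA Ay.
  have [[Ex xdens xtwo] _ _] := Ax; have [[Ey ydens _] _ _] := Ay.
  have := eucl_dist_ge0 x y; rewrite le_eqVlt => /predU1P[<-|xy0].
    by rewrite mulr0 outer_measure_ge0.
  have xyn := cell_dist x y Ax Ay.
  have kxy0 : 0 < kap * eucl_dist x y by exact: mulr_gt0.
  have kxyn : kap * eucl_dist x y < n.+1%:R^-1.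
    by apply: le_lt_trans xyn; rewrite ler_piMl// ltW.
  have := lens_measure_ge Efin (xdens _ kxy0 kxyn) (ydens _ kxy0 kxyn) (xtwo _ xy0 xyn).
  by congr (_%:E <= _)%E; rewrite /c; ring.
have /choice[f fP] := cell_lipschitz.
exists (fun k => if @choice.unpickle (nat * int * int)%type k is Some i
  then f i else fun=> 0).
split.
  move=> k; case: choice.unpickle => [i|]; first exact: (fP i).1.
  by exists 0 => u v; rewrite eucl_distxx mul0r.
apply/eqP; rewrite eq_le outer_measure_ge0 andbT.
have two := two_disks_density kap0 kap1 eta0 Efin.
(* The uncovered part lies in two null sets: the points of density not at least [s], and those where
   the two-disk estimate fails at arbitrarily small scales. *)
rewrite -[leRHS]adde0 -{1}Enull -two.
apply: le_trans (outer_measureU2 _ _ _).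
apply: (le_outer_measure (@hausdorff1 R)) => x [Ex xf].
have [xs|xs] := pselect (s%:E <= lower_density E x)%E; last by left.
right; split => //; apply: contrapT => /existsNP[e].
move=> /not_implyP[e0 /forallNP xe]; apply: xf.
have /lower_density_gt[e' e'0 xe'] : ((3 / 4 + b)%:E < lower_density E x)%E.
  by apply: lt_le_trans xs; rewrite lte_fin.
pose m := Num.min e e'; have m0 : 0 < m by rewrite lt_min e0.
pose n := Num.trunc m^-1.
have nm : n.+1%:R^-1 < m.
  rewrite -[ltRHS]invrK ltf_pV2 ?posrE ?invr_gt0//; exact: truncnS_gt.
have : exists n, En n x; last first.
  move=> [n' Enx]; pose i := (n', Num.floor (x.1 * (4 * n'.+1%:R)),
    Num.floor (x.2 * (4 * n'.+1%:R))).
  have [t _ ft] := (fP i).2 x (And3 Enx erefl erefl).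
  by exists (choice.pickle i) => //; rewrite choice.pickleK; exists t.
exists n; split => // [r r0 rn|y xy0 xyn].
  by apply: xe' => //; apply: lt_trans rn (lt_le_trans nm _); rewrite ge_min lexx orbT.
rewrite leNgt; apply/negP => Exy; apply: (xe y); split => //.
by apply: lt_trans xyn (lt_le_trans nm _); rewrite ge_min lexx.
Qed.

Lemma sigma_bar_le : (sigma_bar R <= (sigmaB R)%:E)%E.
Proof.
apply/lee_addgt0Pr => e e0; apply: ereal_inf_lbound; exists (3 / 4 + e) => //.
by apply: rectifiability_threshold_gt; lra.
Qed.

End rectifiability.

(** * The configuration consisting of the origin *)

Section zero_step.
Context {R : realType}.
Implicit Types (t sigma : R) (r : R * R -> R).
Local Notation O := (origin R).
Local Notation P0 := [fset O]%fset.

Lemma disk_union_origin r : disk_union P0 r = disk (r O) O.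
Proof.
rewrite /disk_union; apply/seteqP; split => [x [p /=]|x rx].
  by rewrite inE => /eqP ->.
by exists O => //=; rewrite inE.
Qed.

Lemma outer_radius_set_neq0 r : r O <= 1 ->
  [set t : R | 0 < t /\ disk_union P0 r `<=` disk t O] 1.
Proof.
move=> r1; split; first exact: ltr01.
by rewrite disk_union_origin; apply: disk_sub; rewrite eucl_distxx add0r.
Qed.

Lemma eucl_dist_horizontal t t' : eucl_dist (t, 0) (t', 0) = `|t - t'|.
Proof. by rewrite /eucl_dist /= subrr expr0n addr0 sqrtr_sqr. Qed.

(** The lower bound serves [sigma <= 3 / 4]; for [sigma > 3 / 4] only radius 1 is tried, where the
    upper bound is sharp. *)
Lemma outer_radius_bounds r : 0 <= r O <= 1 -> r O <= outer_radius P0 r <= 1.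
Proof.
move=> /andP[r0 r1]; have S1 := outer_radius_set_neq0 r1.
apply/andP; split; last first.
  by apply: ge_inf => //; exists 0 => t [/ltW].
apply: lb_le_inf; first by exists 1.
move=> t [t0]; rewrite disk_union_origin leNgt => rt; apply/negP => tr.
have /rt : disk (r O) O ((t + r O) / 2, 0).
  by rewrite /disk /= eucl_dist_horizontal sub0r normrN ger0_norm; lra.
rewrite /disk /= eucl_dist_horizontal sub0r normrN ger0_norm; lra.
Qed.

(** The factor [3 / 2] instead of 2 is attained inside the open disk and suffices, since it is
    compared with [2 * sigma <= 3 / 2]. *)
Lemma diam_disk_ge t : 0 <= t <= 1 -> 3 / 2 * t <= fine (diam (disk t O)).
Proof.
move=> /andP[]; rewrite le_eqVlt => /predU1P[<- _|t0 t1].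
  by rewrite mulr0 fine_ge0// diam_ge0.
have fin : diam (disk t O) \is a fin_num.
  rewrite ge0_fin_numE ?diam_ge0//; apply: (@le_lt_trans _ _ (2 * t)%:E);
    last exact: ltry.
  apply: diam_le => [|x y]; first by lra.
  rewrite /disk /= => xt yt; have := eucl_dist_triangle O x y.
  by rewrite (eucl_distC x O); lra.
rewrite -lee_fin fineK//.
have D u : `|u| < t -> disk t O (u, 0).
  by rewrite /disk /= eucl_dist_horizontal sub0r normrN.
have D1 : disk t O (3 / 4 * t, 0) by apply: D; rewrite ger0_norm; lra.
have D2 : disk t O (- (3 / 4 * t), 0) by apply: D; rewrite normrN ger0_norm; lra.
apply: le_trans (diam_ge D1 D2); rewrite lee_fin eucl_dist_horizontal opprK.
by rewrite ger0_norm; lra.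
Qed.

Lemma radii_origin r : radii P0 r <-> 0 <= r O <= 1.
Proof.
split=> [[r01 _]|r01]; first by apply: r01; rewrite inE.
split=> [p|p p']; first by rewrite inE => /eqP ->.
by rewrite !inE => /eqP -> /eqP ->.
Qed.

Lemma zero_step_gt0 sigma : 2^-1 <= sigma <= 1 ->
  ((0 < OneMinM 0 sigma)%E <-> sigmaB R < sigma).
Proof.
move=> /andP[sigma2 _]; have sigma0 : 0 < sigma by lra.
have -> : OneMinM 0 sigma = (Mval sigma P0)%:E.
  by rewrite /OneMinM /= image_set1 ereal_inf1.
rewrite lte_fin /sigmaB /Mval.
have FE r : Fval sigma P0 r = r O - (2 * sigma)^-1 *
    Num.min (fine (diam (disk (r O) O))) (2^-1 + outer_radius P0 r).
  by rewrite /Fval big_seq_fset1 disk_union_origin.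
have radii1 : radii P0 (fun=> 1 : R) by apply/radii_origin; rewrite ler01 lexx.
have c0 : 0 < (2 * sigma)^-1 by rewrite invr_gt0 mulr_gt0.
split => [|sigmaB].
  apply: contra_ltT; rewrite -leNgt => sigmaB; apply: ge_sup.
    by exists (Fval sigma P0 (fun=> 1)), (fun=> 1).
  move=> _ [r /radii_origin r01 <-]; rewrite FE subr_le0.
  rewrite mulrC ler_pdivlMr ?mulr_gt0// le_min.
  have := diam_disk_ge r01; have /andP[out _] := outer_radius_bounds r01.
  move: r01 => /andP[r0 r1] dm.
  (* Both entries of the minimum are at least [3 / 2 * r O], the second because [r O <= 1]. *)
  by apply/andP; split; nra.
apply: (@lt_le_trans _ _ (Fval sigma P0 (fun=> 1))).
  (* At radius 1 the second entry is at most [3 / 2 < 2 * sigma]. *)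
  rewrite FE subr_gt0 mulrC ltr_pdivrMr ?mulr_gt0// gt_min; apply/orP; right.
  have /andP[_] := @outer_radius_bounds (fun=> 1) (iffLR (radii_origin _) radii1).
  lra.
apply: ub_le_sup; last by exists (fun=> 1).
exists 1 => _ [r /radii_origin r01 <-]; rewrite FE.
have /andP[out _] := outer_radius_bounds r01; move: (r01) => /andP[r0 r1].
have : 0 <= (2 * sigma)^-1 *
    Num.min (fine (diam (disk (r O) O))) (2^-1 + outer_radius P0 r).
  apply: mulr_ge0; first exact: ltW.
  by rewrite le_min fine_ge0 ?diam_ge0//=; lra.
lra.
Qed.

End zero_step.

Theorem theorem3p2 (R : realType) :
  (forall sigma : R, 2^-1 <= sigma <= 1 ->
     ((0 < OneMinM 0 sigma)%E <-> sigmaB R < sigma)) /\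
  (sigma_bar R <= (sigmaB R)%:E)%E.
Proof. by split; [exact: zero_step_gt0|exact: sigma_bar_le]. Qed.
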